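(* For any diagonal section $\delta$ the following are equivalent: (i) $\overline{C}_\delta=A_\delta$; (ii) $y-x\ge\max\{\widehat{\delta}(x),\widehat{\delta}(y)\}$ whenever $x,y\in[0,1]$ are such that $x<y$, the derivatives $\widehat{\delta}'(x)$ and $\widehat{\delta}'(y)$ exist, and $\widehat{\delta}'(x)<0<\widehat{\delta}'(y)$.
   Context: $\mathbb{I}=[0,1]$. A (bivariate) copula is a function $C\colon\mathbb{I}^2\to\mathbb{I}$ with $C(x,0)=C(0,y)=0$, $C(x,1)=x$, $C(1,y)=y$ for all $x,y$, and $C(b,d)+C(a,c)-C(b,c)-C(a,d)\ge 0$ for all $a\le b$, $c\le d$. A quasi-copula is a function $Q\colon\mathbb{I}^2\to\mathbb{I}$ with $Q(x,0)=Q(0,y)=0$, $Q(x,1)=x$, $Q(1,y)=y$, increasing in each variable and 1-Lipschitz in each variable. A diagonal section is a function $\delta\colon\mathbb{I}\to\mathbb{I}$ with $\delta(x)\le x$ for all $x$, $0\le\delta(y)-\delta(x)\le 2(y-x)$ whenever $x\le y$, and $\delta(1)=1$. Write $\widehat{\delta}(x)=x-\delta(x)$. Define $\overline{C}_\delta(x,y)=\sup\{C(x,y): C \text{ a copula with } C(t,t)=\delta(t)\ \forall t\}$ and $A_\delta(x,y)=\sup\{Q(x,y): Q \text{ a quasi-copula with } Q(t,t)=\delta(t)\ \forall t\}$. *)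

(* Defs.v *)
From Stdlib Require Import Reals Lra.
From Coquelicot Require Import Coquelicot.
Open Scope R_scope.

Definition inI (x : R) : Prop := 0 <= x <= 1.

(* Bivariate copula (values outside I^2 are irrelevant). *)
Definition is_copula (C : R -> R -> R) : Prop :=
  (forall x y, inI x -> inI y -> inI (C x y)) /\
  (forall x, inI x -> C x 0 = 0 /\ C 0 x = 0 /\ C x 1 = x /\ C 1 x = x) /\
  (forall a b c d, inI a -> inI b -> inI c -> inI d -> a <= b -> c <= d ->
      C b d + C a c - C b c - C a d >= 0).

Definition is_quasi_copula (Q : R -> R -> R) : Prop :=
  (forall x y, inI x -> inI y -> inI (Q x y)) /\
  (forall x, inI x -> Q x 0 = 0 /\ Q 0 x = 0 /\ Q x 1 = x /\ Q 1 x = x) /\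
  (forall x1 x2 y, inI x1 -> inI x2 -> inI y -> x1 <= x2 ->
      Q x1 y <= Q x2 y /\ Q y x1 <= Q y x2) /\
  (forall x1 x2 y, inI x1 -> inI x2 -> inI y ->
      Rabs (Q x1 y - Q x2 y) <= Rabs (x1 - x2) /\
      Rabs (Q y x1 - Q y x2) <= Rabs (x1 - x2)).

Definition is_diagonal_section (delta : R -> R) : Prop :=
  (forall x, inI x -> inI (delta x)) /\
  (forall x, inI x -> delta x <= x) /\
  (forall x y, inI x -> inI y -> x <= y ->
      0 <= delta y - delta x <= 2 * (y - x)) /\
  delta 1 = 1.

Definition delta_hat (delta : R -> R) (x : R) : R := x - delta x.

Definition has_diagonal (C : R -> R -> R) (delta : R -> R) : Prop :=
  forall t, inI t -> C t t = delta t.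

Definition Cbar (delta : R -> R) (x y : R) : Rbar :=
  Lub_Rbar (fun z => exists C, is_copula C /\ has_diagonal C delta /\ z = C x y).

Definition Adelta (delta : R -> R) (x y : R) : Rbar :=
  Lub_Rbar (fun z => exists Q, is_quasi_copula Q /\ has_diagonal Q delta /\ z = Q x y).

(* f : I -> R has derivative l at x (x in I), as a function on I
   (one-sided at the endpoints). *)
Definition has_derivative_on_I (f : R -> R) (x l : R) : Prop :=
  forall eps, 0 < eps -> exists d, 0 < d /\
    forall h, h <> 0 -> Rabs h < d -> inI (x + h) ->
      Rabs ((f (x + h) - f x) / h - l) < eps.

(* Main.v *)
(** Write [d = delta_hat delta]. For [x <= y] every quasi-copula with diagonal
    section [delta] satisfies [Q x y <= min x (y - max_[x,y] d)], and this bound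
    is itself such a quasi-copula. A copula with diagonal section [delta]
    satisfies the sharper [C x y <= y - d x - sum (d t_(i+1) - d t_i)^+] along
    any partition of [[x, y]], so equality of the two suprema forces [d] to be
    nondecreasing and then nonincreasing on [[x, y]] whenever
    [max_[x,y] d > y - x].
    Condition (ii) yields this unimodality because a Lipschitz function that is
    not nondecreasing has a negative derivative at some point. Conversely, if
    [d] is unimodal on [[a, b]] with maximum at [t], the copula
    [min (x, y, B x + A y)] attains the bound at [(a, b)], where
    [A + B = delta], [B] is constant on [[a, t]] and [A] has slope 1 on
    [[t, b]]. When [max_[x,y] d < y - x], shrinking [y] to the point [z] with
    [max_[x,z] d = z - x] reduces to this case, by monotonicity. *)
Require Import Defs.
From HB Require structures.
From mathcomp Require all_boot all_order all_algebra.
From mathcomp Require all_classical all_reals all_analysis.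
From mathcomp.reals_stdlib Require Rstruct.
From mathcomp Require ring lra.

(** * Decrease and negative derivatives of Lipschitz functions, by Radon-Nikodym *)

Module LipschitzDerivative.

Import HB.structures.
Import all_boot all_order all_algebra all_classical all_reals all_analysis.
Import mathcomp.algebra_tactics.ring mathcomp.algebra_tactics.lra.
Set Implicit Arguments.
Unset Strict Implicit.
Unset Printing Implicit Defensive.
Import Order.TTheory GRing.Theory Num.Def Num.Theory.
Import numFieldNormedType.Exports.
Local Open Scope classical_set_scope.
Local Open Scope ring_scope.

Lemma lebesgue_stieltjes_measure_itvoc (R : realType) (F : cumulative R R)
    (a b : R) : a <= b ->
  lebesgue_stieltjes_measure F `]a, b]%classic = (F b - F a)%:E.
Proof.
move=> ab; rewrite /lebesgue_stieltjes_measure /measure_extension.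
by rewrite measurable_mu_extE/= ?wlength_itv_bnd//; exact: is_ocitv.
Qed.

Section lipschitz_derivative.
Context {R : realType}.
Notation mu := (@lebesgue_measure R).
Variable f : R -> R.
Hypothesis lipf : forall x y, `|f x - f y| <= `|x - y|.

(* The Stieltjes measures of these two nondecreasing functions add up to the
   Lebesgue measure, so each of them is absolutely continuous. *)
Let half_sum x := (x + f x) / 2.
Let half_diff x := (x - f x) / 2.

Lemma lip_bounds x y : x <= y -> - (y - x) <= f y - f x <= y - x.
Proof.
by move=> xy; rewrite -ler_norml -[leRHS]ger0_norm ?subr_ge0.
Qed.

Let half_sum_nd : nondecreasing half_sum.
Proof.
by move=> x y xy; have /andP[] := lip_bounds xy; rewrite /half_sum; lra.
Qed.

Let half_diff_nd : nondecreasing half_diff.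
Proof.
by move=> x y xy; have /andP[] := lip_bounds xy; rewrite /half_diff; lra.
Qed.

Lemma lip_continuous : continuous f.
Proof.
move=> x; apply/cvgrPdist_le => e e0; near=> y.
apply: (le_trans (lipf x y)); near: y.
exact: cvgr_dist_le.
Unshelve. all: by end_near. Qed.

Let half_sum_rc : right_continuous half_sum.
Proof.
apply: right_continuousW => x; apply: cvgMr_tmp.
by apply: cvgD; [exact: cvg_id|exact: lip_continuous].
Qed.

Let half_diff_rc : right_continuous half_diff.
Proof.
apply: right_continuousW => x; apply: cvgMr_tmp.
by apply: cvgB; [exact: cvg_id|exact: lip_continuous].
Qed.

HB.instance Definition _ := isCumulative.Build R _ R half_sum half_sum_nd half_sum_rc.
HB.instance Definition _ := isCumulative.Build R _ R half_diff half_diff_nd half_diff_rc.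

Let nu := lebesgue_stieltjes_measure half_sum.

Let nu_le_mu A : measurable A -> (nu A <= mu A)%E.
Proof.
move=> mA; pose nu' := lebesgue_stieltjes_measure half_diff.
suff -> : mu A = (nu A + nu' A)%E by rewrite leeDl.
rewrite -measure_addE; apply: lebesgue_measure_unique mA => X [[a b] _ <-] /=.
have [ab|ba] := leP a b; last first.
  by rewrite set_itv_ge ?measure0// -leNgt bnd_simp ltW.
rewrite [RHS]measure_addE /lebesgue_measure lebesgue_stieltjes_measure_itvoc//.
transitivity ((half_sum b - half_sum a)%:E + (half_diff b - half_diff a)%:E)%E.
  by rewrite -EFinD; congr EFin; rewrite /half_sum /half_diff /=; field.
by congr (_ + _)%E; apply/esym; exact: lebesgue_stieltjes_measure_itvoc.
Qed.

(** Restriction to []p, q]] makes [nu] finite and [nu_le_mu] makes it absolutely continuous, so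
    Radon-Nikodym gives a density whose integrals recover [half_sum]. *)
Let density (p q : R) : p <= q -> exists h : R -> R,
  [/\ mu.-integrable setT (EFin \o h), forall x, 0 <= h x &
    forall x, p <= x <= q ->
      ((half_sum x - half_sum p)%:E = \int[mu]_(t in `]p, x]) (h t)%:E)%E].
Proof.
move=> pq.
have mD : measurable (`]p, q]%classic : set (measurableTypeR R)).
  exact: measurable_itv.
have nuD : (nu `]p, q]%classic < +oo)%E.
  by rewrite /nu lebesgue_stieltjes_measure_itvoc// ltry.
have dom : mfrestr mD nuD `<< mu.
  apply/null_content_dominatesP => A mA A0; apply/eqP.
  rewrite eq_le measure_ge0 andbT -A0.
  apply: (le_trans (nu_le_mu _)); first exact: measurableI.
  by apply: le_measure; rewrite ?inE//; exact: measurableI.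
have [h [h0 hfin inth hE]] := radon_nikodym_sigma_finite dom.
have fineh : EFin \o (fine \o h) = h.
  by apply/funext => x /=; rewrite fineK.
exists (fine \o h); split.
- by rewrite fineh.
- by move=> x; rewrite fine_ge0.
- move=> x /andP[px xq].
  under eq_integral do rewrite /= fineK//.
  rewrite -hE; last exact: measurable_itv.
  transitivity (nu (`]p, x]%classic `&` `]p, q]%classic)) => //.
  rewrite setIidl; last by apply: subset_itvl; rewrite bnd_simp.
  by rewrite /nu lebesgue_stieltjes_measure_itvoc.
Qed.


(** By Lebesgue differentiation [f' = 2 h - 1] almost everywhere on []p, q[]. If this were never
    negative, then [h >= 1/2] almost everywhere, and integration would give
    [half_sum q - half_sum p >= (q - p) / 2], that is [f q >= f p]. *)
Lemma lipschitz_decrease_derivative (p q : R) : p < q -> f q < f p ->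
  exists x l : R, [/\ p < x < q, l < 0 &
    h^-1 * (f (h + x) - f x) @[h --> 0^'] --> l].
Proof.
move=> pq fqp; have [h [inth h0 hE]] := density (ltW pq).
have loch : locally_integrable setT h.
  by apply: open_integrable_locally => //; exact: openT.
have inty y : mu.-integrable [set` Interval (BRight p) (BRight y)] (EFin \o h).
  by apply: integrableS inth => //; exact: measurable_itv.
have ftc := FTC1 inty loch.
apply: contrapT => nex.
have hge : {ae mu, forall x, `]p, q[%classic x -> ((2^-1)%:E <= (h x)%:E)%E}.
  move: ftc; apply: filterS; first exact: (ae_filter_ringOfSetsType mu).
  move=> x /= Fx; rewrite in_itv/= => /andP[px xq].
  have [dF F'x] := Fx px.
  rewrite lee_fin leNgt; apply/negP => hx.
  apply: nex; exists x, (2 * h x - 1); split; [by rewrite px|lra|].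
  pose F y := (\int[mu]_(t in `]p, y]) h t)%R.
  have FE y : p <= y <= q -> F y = half_sum y - half_sum p.
    by move=> pyq; rewrite /F /Rintegral -hE.
  have Fcvg : d^-1 * (F (d + x) - F x) @[d --> 0^'] --> h x.
    rewrite -F'x derive1E.
    have : d^-1 *: (F (d *: 1 + x) - F x) @[d --> 0^'] --> 'D_1 F x by exact: dF.
    by under eq_fun do rewrite /GRing.scale/= mulr1.
  have : 2 * (d^-1 * (F (d + x) - F x)) - 1 @[d --> 0^'] --> 2 * h x - 1.
    by apply: cvgB; [apply: cvgM Fcvg; exact: cvg_cst|exact: cvg_cst].
  (* For small [d] the point [d + x] stays in [[p, q]], where [F] is [half_sum] up to a constant;
     the quotient of [f] is twice that of [half_sum] minus 1. *)
  apply: cvg_trans; apply: near_eq_cvg; near=> d.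
  have d0 : d != 0 by near: d; exact: nbhs_dnbhs_neq.
  have xdpq : `|d| <= Num.min (x - p) (q - x).
    by near: d; apply: dnbhs0_le; rewrite lt_min !subr_gt0 px.
  have dxpq : p <= d + x <= q.
    move: xdpq; rewrite le_min !ler_norml => /andP[/andP[? ?] /andP[? ?]].
    by apply/andP; split; lra.
  rewrite !FE ?(ltW px) ?(ltW xq)// /half_sum; field.
  by rewrite d0.
have mI : measurable (`]p, q[%classic : set (measurableTypeR R)).
  exact: measurable_itv.
have /integrableP[mh _] := inth.
have : (\int[mu]_(t in `]p, q[) (2^-1)%:E <= \int[mu]_(t in `]p, q[) (h t)%:E)%E.
  apply: ae_ge0_le_integral => //.
  - by move=> x _; rewrite lee_fin.
  - exact: measurable_funS mh.
rewrite [X in (_ <= X)%E]integral_itv_bndo_bndc; last exact: measurable_funS mh.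
rewrite -hE ?lexx ?(ltW pq)// integral_cst//= lebesgue_measure_itv/= lte_fin pq.
by rewrite -EFinD -EFinM lee_fin /half_sum; lra.
Unshelve. all: by end_near. Qed.

Lemma decrease_derivative_eps_delta (p q : R) : p < q -> f q < f p ->
  exists x l : R, [/\ p < x < q, l < 0 & forall e, 0 < e ->
    exists2 d, 0 < d & forall h, h != 0 -> `|h| < d ->
      `|(f (x + h) - f x) / h - l| < e].
Proof.
move=> pq fqp; have [x [l [pxq l0 fl]]] := lipschitz_decrease_derivative pq fqp.
exists x, l; split => // e e0.
move/cvgrPdist_lt : fl => /(_ _ e0)[d /= d0 fd].
exists d => // h h0 hd; rewrite (addrC x) (mulrC _ h^-1) distrC.
by apply: fd => //=; rewrite sub0r normrN.
Qed.

End lipschitz_derivative.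

End LipschitzDerivative.

From Stdlib Require Import Reals Lra.
From Coquelicot Require Import Coquelicot.
Open Scope R_scope.

(** * Lipschitz functions and their derivatives *)

(** Transport to the reals of the standard library, in the epsilon-delta form that
    [has_derivative_on_I] uses. *)
Lemma lipschitz_decrease_derivative (f : R -> R) (p q : R) :
  (forall x y, Rabs (f x - f y) <= Rabs (x - y)) -> p < q -> f q < f p ->
  exists s l, p < s < q /\ l < 0 /\
    forall eps, 0 < eps -> exists d, 0 < d /\
      forall h, h <> 0 -> Rabs h < d ->
        Rabs ((f (s + h) - f s) / h - l) < eps.
Proof.
intros Hf Hpq Hfpq.
destruct (@LipschitzDerivative.decrease_derivative_eps_delta
  Rstruct.RbaseSymbolsImpl_R__canonical__reals_Real f) with (p := p) (q := q)
  as [s [l [Hs Hl Hd]]].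
- intros x y; rewrite <- !Rstruct.RabsE; apply (ssrbool.introT Rstruct.RleP), Hf.
- apply (ssrbool.introT Rstruct.RltP); assumption.
- apply (ssrbool.introT Rstruct.RltP); assumption.
- exists s, l; split; [|split].
  + destruct (ssrbool.elimT ssrbool.andP Hs) as [H1 H2].
    split; apply (ssrbool.elimT Rstruct.RltP); assumption.
  + apply (ssrbool.elimT Rstruct.RltP); assumption.
  + intros e He.
    destruct (Hd e (ssrbool.introT Rstruct.RltP He)) as [d Hd0 Hdd].
    exists d; split; [apply (ssrbool.elimT Rstruct.RltP); assumption|].
    intros h Hh Hhd; apply (ssrbool.elimT Rstruct.RltP).
    rewrite Rstruct.RabsE, Rstruct.RdivE.
    apply Hdd.
    * apply (ssrbool.introN eqtype.eqP), Hh.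
    * rewrite <- Rstruct.RabsE; apply (ssrbool.introT Rstruct.RltP), Hhd.
Qed.

Lemma lipschitz_le (f : R -> R) :
  (forall x y, x <= y -> - (y - x) <= f y - f x <= y - x) ->
  forall x y, Rabs (f x - f y) <= Rabs (x - y).
Proof.
intros Hf x y; destruct (Rle_dec x y) as [Hxy|Hxy].
- specialize (Hf x y Hxy).
  rewrite (Rabs_left1 (x - y)) by lra; apply Rabs_le; lra.
- specialize (Hf y x ltac:(lra)).
  rewrite (Rabs_pos_eq (x - y)) by lra; apply Rabs_le; lra.
Qed.

Lemma lipschitz_continuity (f : R -> R) :
  (forall x y, Rabs (f x - f y) <= Rabs (x - y)) -> continuity f.
Proof.
intros Hf x eps Heps; exists eps; split; [exact Heps|].
intros y [_ Hy]; unfold dist in *; simpl in *; unfold Rdist in *.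
apply Rle_lt_trans with (2 := Hy), Hf.
Qed.

(** * Running maxima *)

(** [real] makes the supremum total; it is a genuine maximum when [f] is continuous and [x <= y]. *)
Definition range_max (f : R -> R) (x y : R) : R :=
  real (Lub_Rbar (fun z => exists t, x <= t <= y /\ z = f t)).

Lemma range_max_attained (f : R -> R) (x y : R) :
  continuity f -> x <= y ->
  exists t, x <= t <= y /\ range_max f x y = f t /\
    forall s, x <= s <= y -> f s <= f t.
Proof.
intros Hf Hxy.
destruct (continuity_ab_maj f x y Hxy (fun c _ => Hf c)) as [t [Ht1 Ht2]].
exists t; split; [exact Ht2|split; [|exact Ht1]].
unfold range_max.
replace (Lub_Rbar _) with (Finite (f t)); [reflexivity|].
symmetry; apply is_lub_Rbar_unique; split.
- intros z [s [Hs ->]]; apply Ht1, Hs.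
- intros b Hb; apply Hb; exists t; split; [exact Ht2|reflexivity].
Qed.

Section RangeMax.

Variable f : R -> R.
Hypothesis Hf : forall x y, x <= y -> - (y - x) <= f y - f x <= y - x.

Let f_continuity : continuity f.
Proof. apply lipschitz_continuity, lipschitz_le, Hf. Qed.

Lemma range_max_ub (x y t : R) : x <= t <= y -> f t <= range_max f x y.
Proof.
intros Ht.
destruct (range_max_attained f x y f_continuity ltac:(lra)) as [s [_ [-> Hs]]].
apply Hs, Ht.
Qed.

Lemma range_max_diag (x : R) : range_max f x x = f x.
Proof.
destruct (range_max_attained f x x f_continuity ltac:(lra)) as [s [Hs [-> _]]].
f_equal; lra.
Qed.

(** A maximizer on [[x, y']] either lies in [[x, y]] or lies beyond [y], where [f] exceeds [f y] by
    at most [y' - y]. *)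
Lemma range_max_right (x y y' : R) : x <= y -> y <= y' ->
  0 <= range_max f x y' - range_max f x y <= y' - y.
Proof.
intros Hxy Hyy'; split.
- destruct (range_max_attained f x y f_continuity Hxy) as [s [Hs [-> _]]].
  assert (H := range_max_ub x y' s ltac:(lra)); lra.
- destruct (range_max_attained f x y' f_continuity ltac:(lra))
    as [s [Hs [-> _]]].
  destruct (Rle_dec s y) as [Hsy|Hsy].
  + assert (H := range_max_ub x y s ltac:(lra)); lra.
  + assert (H := range_max_ub x y y ltac:(lra)).
    assert (H' := Hf y s ltac:(lra)); lra.
Qed.

Lemma range_max_left (x x' y : R) : x <= x' -> x' <= y ->
  0 <= range_max f x y - range_max f x' y <= x' - x.
Proof.
intros Hxx' Hxy; split.
- destruct (range_max_attained f x' y f_continuity Hxy) as [s [Hs [-> _]]].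
  assert (H := range_max_ub x y s ltac:(lra)); lra.
- destruct (range_max_attained f x y f_continuity ltac:(lra))
    as [s [Hs [-> _]]].
  destruct (Rle_dec x' s) as [Hsx|Hsx].
  + assert (H := range_max_ub x' y s ltac:(lra)); lra.
  + assert (H := range_max_ub x' y x' ltac:(lra)).
    assert (H' := Hf s x' ltac:(lra)); lra.
Qed.

End RangeMax.

(** * Copulas and quasi-copulas *)

Lemma inI_0 : inI 0.
Proof. unfold inI; lra. Qed.

Lemma inI_1 : inI 1.
Proof. unfold inI; lra. Qed.

Section CopulaBasics.

Variable C : R -> R -> R.
Hypothesis HC : is_copula C.

Lemma copula_mono_l (x1 x2 y : R) :
  inI x1 -> inI x2 -> inI y -> x1 <= x2 -> 0 <= C x2 y - C x1 y <= x2 - x1.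
Proof.
destruct HC as [_ [HB HV]]; intros H1 H2 Hy H12.
assert (V1 := HV x1 x2 0 y H1 H2 inI_0 Hy H12 ltac:(unfold inI in *; lra)).
assert (V2 := HV x1 x2 y 1 H1 H2 Hy inI_1 H12 ltac:(unfold inI in *; lra)).
assert (B1 := HB x1 H1); assert (B2 := HB x2 H2); lra.
Qed.

Lemma copula_transpose : is_copula (fun x y => C y x).
Proof.
destruct HC as [HR [HB HV]]; split; [|split].
- intros x y Hx Hy; apply HR; assumption.
- intros x Hx; destruct (HB x Hx) as [? [? [? ?]]]; auto.
- intros a b c d Ha Hb Hc Hd Hab Hcd.
  assert (V := HV c d a b Hc Hd Ha Hb Hcd Hab); lra.
Qed.

End CopulaBasics.

Lemma copula_mono_r (C : R -> R -> R) (HC : is_copula C) (x1 x2 y : R) :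
  inI x1 -> inI x2 -> inI y -> x1 <= x2 -> 0 <= C y x2 - C y x1 <= x2 - x1.
Proof. apply (copula_mono_l _ (copula_transpose C HC)). Qed.

Lemma slope_quasi_copula (Q : R -> R -> R) :
  (forall x, inI x -> Q x 0 = 0 /\ Q 0 x = 0 /\ Q x 1 = x /\ Q 1 x = x) ->
  (forall x1 x2 y, inI x1 -> inI x2 -> inI y -> x1 <= x2 ->
     0 <= Q x2 y - Q x1 y <= x2 - x1 /\ 0 <= Q y x2 - Q y x1 <= x2 - x1) ->
  is_quasi_copula Q.
Proof.
intros HB HS; split; [|split; [exact HB|split]].
- intros x y Hx Hy.
  destruct (HS 0 y x inI_0 Hy Hx ltac:(unfold inI in *; lra)) as [_ H0].
  destruct (HS y 1 x Hy inI_1 Hx ltac:(unfold inI in *; lra)) as [_ H1].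
  assert (B := HB x Hx); unfold inI in *; lra.
- intros x1 x2 y H1 H2 Hy H12; destruct (HS x1 x2 y H1 H2 Hy H12); lra.
- intros x1 x2 y H1 H2 Hy; destruct (Rle_dec x1 x2) as [H|H].
  + destruct (HS x1 x2 y H1 H2 Hy H).
    rewrite (Rabs_left1 (x1 - x2)) by lra; split; apply Rabs_le; lra.
  + destruct (HS x2 x1 y H2 H1 Hy ltac:(lra)).
    rewrite (Rabs_pos_eq (x1 - x2)) by lra; split; apply Rabs_le; lra.
Qed.

Lemma copula_quasi_copula (C : R -> R -> R) : is_copula C -> is_quasi_copula C.
Proof.
intros HC; apply slope_quasi_copula; [apply HC|].
intros x1 x2 y H1 H2 Hy H12; split.
- apply (copula_mono_l C HC); assumption.
- apply (copula_mono_r C HC); assumption.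
Qed.

Lemma quasi_copula_transpose (Q : R -> R -> R) :
  is_quasi_copula Q -> is_quasi_copula (fun x y => Q y x).
Proof.
intros [HR [HB [HM HL]]]; split; [|split; [|split]].
- intros x y Hx Hy; apply HR; assumption.
- intros x Hx; destruct (HB x Hx) as [? [? [? ?]]]; auto.
- intros x1 x2 y H1 H2 Hy H12; destruct (HM x1 x2 y H1 H2 Hy H12); auto.
- intros x1 x2 y H1 H2 Hy; destruct (HL x1 x2 y H1 H2 Hy); auto.
Qed.

(** Monotonicity gives [Q x y <= Q x 1 = x] and [Q x y <= Q t y]; the Lipschitz condition gives
    [Q t y <= Q t t + (y - t)]. *)
Lemma quasi_copula_upper_bound (Q : R -> R -> R) (delta : R -> R) (x t y : R) :
  is_quasi_copula Q -> has_diagonal Q delta -> inI x -> inI y -> x <= t <= y ->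
  Q x y <= Rmin x (y - delta_hat delta t).
Proof.
intros [HR [HB [HM HL]]] HD Hx Hy Ht; unfold delta_hat.
assert (It : inI t) by (unfold inI in *; lra).
destruct (HM y 1 x Hy inI_1 Hx ltac:(unfold inI in *; lra)) as [_ M1].
destruct (HM x t y Hx It Hy ltac:(lra)) as [M2 _].
destruct (HL y t t Hy It It) as [_ L].
rewrite (Rabs_pos_eq (y - t)) in L by lra; apply Rabs_le_between in L.
rewrite HD in L by assumption.
assert (B := HB x Hx); apply Rmin_glb; lra.
Qed.

(* The mass that the strip [v, w] carries to the left of [s] is at most its
   mass to the left of [v], and also at most its total mass. *)
Lemma copula_strip_bound (C : R -> R -> R) (delta : R -> R) (s v w : R) :
  is_copula C -> has_diagonal C delta -> inI s -> inI w -> s <= v -> v <= w ->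
  C s w - C s v <= delta w - delta v /\ C s w - C s v <= w - v.
Proof.
intros HC HD Hs Hw Hsv Hvw.
assert (Hv : inI v) by (unfold inI in *; lra).
assert (V := proj2 (proj2 HC) s v v w Hs Hv Hv Hw Hsv Hvw).
assert (M1 := copula_mono_l C HC v w w Hv Hw Hw Hvw).
assert (M2 := copula_mono_r C HC v w s Hv Hw Hs Hvw).
rewrite <- (HD w Hw), <- (HD v Hv); lra.
Qed.

(** * Copulas from a decomposition of the diagonal section *)

Definition slow (A : R -> R) (p q : R) : Prop :=
  forall x y, p <= x -> x <= y -> y <= q -> 0 <= A y - A x <= y - x.

Lemma slow_glue (A : R -> R) (p r q : R) :
  p <= r <= q -> slow A p r -> slow A r q -> slow A p q.
Proof.
intros Hr H1 H2 x y Hx Hxy Hy.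
destruct (Rle_dec y r) as [Hyr|Hyr]; [apply H1; lra|].
destruct (Rle_dec r x) as [Hrx|Hrx]; [apply H2; lra|].
assert (K1 := H1 x r ltac:(lra) ltac:(lra) ltac:(lra)).
assert (K2 := H2 r y ltac:(lra) ltac:(lra) ltac:(lra)); lra.
Qed.

Lemma slow_ext (A B : R -> R) (p q : R) :
  (forall x, p <= x <= q -> A x = B x) -> slow B p q -> slow A p q.
Proof.
intros H HB x y Hx Hxy Hy.
rewrite !H by lra; apply HB; lra.
Qed.

(* The summands are the cumulative masses that the second and the first
   margin, respectively, match with earlier mass of the other margin. *)
Lemma min_sum_copula (delta A B : R -> R) :
  is_diagonal_section delta -> (forall x, inI x -> A x + B x = delta x) ->
  slow A 0 1 -> slow B 0 1 ->
  is_copula (fun x y => Rmin (Rmin x y) (B x + A y)) /\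
  has_diagonal (fun x y => Rmin (Rmin x y) (B x + A y)) delta.
Proof.
intros [HdI [Hdx [Hd2 Hd1]]] HAB HA HB.
(* As [delta 0 = 0] and [delta 1 = 1], the sums [A 0 + B 0] and [A 1 + B 1] are 0 and 1; with [FA]
   and [FB] this yields the boundary values and the range. *)
assert (A0B0 := HAB 0 inI_0); assert (A1B1 := HAB 1 inI_1).
assert (d0 := HdI 0 inI_0); assert (d0' := Hdx 0 inI_0).
assert (FA : forall x, inI x -> A 0 <= A x <= A 0 + x /\ A x <= A 1 <= A x + 1 - x).
{ intros x [Hx1 Hx2].
  assert (K1 := HA 0 x ltac:(lra) ltac:(lra) ltac:(lra)).
  assert (K2 := HA x 1 ltac:(lra) ltac:(lra) ltac:(lra)); lra. }
assert (FB : forall x, inI x -> B 0 <= B x <= B 0 + x /\ B x <= B 1 <= B x + 1 - x).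
{ intros x [Hx1 Hx2].
  assert (K1 := HB 0 x ltac:(lra) ltac:(lra) ltac:(lra)).
  assert (K2 := HB x 1 ltac:(lra) ltac:(lra) ltac:(lra)); lra. }
assert (HM : forall x y, let m := Rmin (Rmin x y) (B x + A y) in
  m <= x /\ m <= y /\ m <= B x + A y /\ (m = x \/ m = y \/ m = B x + A y)).
{ intros x y; unfold Rmin; repeat destruct Rle_dec; lra. }
unfold is_copula, has_diagonal, inI in *; cbv beta.
split; [split; [|split]|].
- intros x y Hx Hy; assert (K := HM x y); simpl in K.
  assert (K1 := FA y Hy); assert (K2 := FB x Hx); lra.
- intros x Hx.
  assert (K1 := HM x 0); assert (K2 := HM 0 x); assert (K3 := HM x 1);
  assert (K4 := HM 1 x); simpl in *.
  assert (J1 := FA x Hx); assert (J2 := FB x Hx); lra.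
(* For each pair of terms attaining the minimum at [(b, d)] and [(a, c)], suitable terms bound the
   other two corners; the slopes of [A] and [B] settle the mixed pairs. *)
- intros a b c d Ha Hb Hc Hd Hab Hcd.
  assert (K1 := HM b d); assert (K2 := HM a c); assert (K3 := HM b c);
  assert (K4 := HM a d); simpl in *.
  assert (J1 := HA c d ltac:(lra) ltac:(lra) ltac:(lra)).
  assert (J2 := HB a b ltac:(lra) ltac:(lra) ltac:(lra)).
  lra.
- intros t Ht; assert (K := HM t t); simpl in K.
  assert (J1 := HAB t Ht); assert (J2 := Hdx t Ht); lra.
Qed.

Lemma slow_min (A B : R -> R) (p q : R) :
  slow A p q -> slow B p q -> slow (fun x => Rmin (A x) (B x)) p q.
Proof.
intros HA HB x y Hx Hxy Hy.
assert (KA := HA x y Hx Hxy Hy); assert (KB := HB x y Hx Hxy Hy).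
unfold Rmin; repeat destruct Rle_dec; lra.
Qed.

(** The summand [A] of the decomposition: half of [delta] outside [[a, b]], all of its growth on
    [[a, t]], slope 1 on [[t, b]]. The constants make the pieces fit continuously. *)
Definition second_share (delta : R -> R) (a t b x : R) : R :=
  if Rle_dec x a then delta x / 2
  else if Rle_dec x t then delta x - delta a / 2
  else if Rle_dec x b then delta t - delta a / 2 + (x - t)
  else delta t - delta a / 2 + (b - t) + (delta x - delta b) / 2.

Section Diagonal.

Variable delta : R -> R.
Hypothesis Hdelta : is_diagonal_section delta.

Lemma delta_slope (x y : R) :
  0 <= x -> x <= y -> y <= 1 -> 0 <= delta y - delta x <= 2 * (y - x).
Proof.
intros; destruct Hdelta as [_ [_ [H2 _]]]; apply H2; unfold inI; lra.
Qed.

(** On [[a, t]] the slope of [A] is at most 1 because [delta_hat] increases there; on [[t, b]] the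
    slope of [B] is nonnegative because [delta_hat] decreases. The other slopes follow from those of
    [delta], and [B a + A b] telescopes to [b - delta_hat delta t]. *)
Lemma unimodal_copula (a t b : R) :
  0 <= a -> a <= t -> t <= b -> b <= 1 ->
  (forall x y, a <= x -> x <= y -> y <= t ->
     delta_hat delta x <= delta_hat delta y) ->
  (forall x y, t <= x -> x <= y -> y <= b ->
     delta_hat delta y <= delta_hat delta x) ->
  exists C, is_copula C /\ has_diagonal C delta /\
    C a b = Rmin a (b - delta_hat delta t).
Proof.
intros Ha Hat Htb Hb Hinc Hdec; unfold delta_hat in *.
set (A := second_share delta a t b).
assert (E1 : forall x, 0 <= x <= a -> A x = delta x / 2).
{ intros x Hx; unfold A, second_share; repeat destruct Rle_dec; lra. }
assert (E2 : forall x, a <= x <= t -> A x = delta x - delta a / 2).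
{ intros x Hx; destruct (Req_dec x a); subst;
  unfold A, second_share; repeat destruct Rle_dec; lra. }
assert (E3 : forall x, t <= x <= b -> A x = delta t - delta a / 2 + (x - t)).
{ intros x Hx; destruct (Req_dec x t); subst; [rewrite E2 by lra; lra|].
  unfold A, second_share; repeat destruct Rle_dec; lra. }
assert (E4 : forall x, b <= x <= 1 ->
  A x = delta t - delta a / 2 + (b - t) + (delta x - delta b) / 2).
{ intros x Hx; destruct (Req_dec x b); subst; [rewrite E3 by lra; lra|].
  unfold A, second_share; repeat destruct Rle_dec; lra. }
assert (glue : forall F, slow F 0 a -> slow F a t -> slow F t b -> slow F b 1 ->
  slow F 0 1).
{ intros F F1 F2 F3 F4.
  apply (slow_glue F 0 a 1); [lra|exact F1|].
  apply (slow_glue F a t 1); [lra|exact F2|].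
  apply (slow_glue F t b 1); [lra|exact F3|exact F4]. }
assert (HA : slow A 0 1).
{ apply glue; intros x y Hx Hxy Hy;
  assert (K := delta_slope x y ltac:(lra) ltac:(lra) ltac:(lra)).
  - rewrite !E1 by lra; lra.
  - rewrite !E2 by lra; specialize (Hinc x y Hx Hxy Hy); lra.
  - rewrite !E3 by lra; lra.
  - rewrite !E4 by lra; lra. }
assert (HB : slow (fun x => delta x - A x) 0 1).
{ apply glue; intros x y Hx Hxy Hy;
  assert (K := delta_slope x y ltac:(lra) ltac:(lra) ltac:(lra)).
  - rewrite !E1 by lra; lra.
  - rewrite !E2 by lra; lra.
  - rewrite !E3 by lra; specialize (Hdec x y Hx Hxy Hy); lra.
  - rewrite !E4 by lra; lra. }
destruct (min_sum_copula delta A (fun x => delta x - A x)) as [HC HD];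
  auto; [intros; lra|].
eexists; split; [exact HC|split; [exact HD|]]; cbv beta.
rewrite E1, E3 by lra.
rewrite (Rmin_left a b) by lra; f_equal; lra.
Qed.

(** * Bounds, extension and derivatives of [delta_hat] *)

Lemma delta_hat_slope (x y : R) : 0 <= x -> x <= y -> y <= 1 ->
  - (y - x) <= delta_hat delta y - delta_hat delta x <= y - x.
Proof. intros; assert (K := delta_slope x y); unfold delta_hat; lra. Qed.

Lemma delta_hat_bounds (x : R) :
  inI x -> 0 <= delta_hat delta x /\ delta_hat delta x <= x /\
           delta_hat delta x <= 1 - x.
Proof.
intros Hx; destruct Hdelta as [HI [Hle [_ H1]]].
assert (K1 := HI x Hx); assert (K2 := Hle x Hx).
assert (K3 := delta_hat_slope x 1).
unfold delta_hat, inI in *; lra.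
Qed.

(** Constant extension beyond [[0, 1]], so that the results on functions Lipschitz on the whole line
    apply. *)
Definition clamped_hat (x : R) : R := delta_hat delta (Rmax 0 (Rmin 1 x)).

Lemma clamped_hatE (x : R) : inI x -> clamped_hat x = delta_hat delta x.
Proof.
intros Hx; unfold clamped_hat, inI in *.
rewrite Rmin_right, Rmax_right by lra; reflexivity.
Qed.

Lemma clamped_hat_slope (x y : R) :
  x <= y -> - (y - x) <= clamped_hat y - clamped_hat x <= y - x.
Proof.
intros Hxy; unfold clamped_hat.
assert (K := delta_hat_slope (Rmax 0 (Rmin 1 x)) (Rmax 0 (Rmin 1 y))).
unfold Rmax, Rmin in *; repeat destruct Rle_dec; lra.
Qed.

Lemma delta_hat_max (x y : R) : 0 <= x -> x <= y -> y <= 1 ->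
  exists t, x <= t <= y /\
    range_max clamped_hat x y = delta_hat delta t /\
    forall s, x <= s <= y -> delta_hat delta s <= delta_hat delta t.
Proof.
intros Hx Hxy Hy.
destruct (range_max_attained clamped_hat x y) as [t [Ht [HM Hs]]].
- apply lipschitz_continuity, lipschitz_le, clamped_hat_slope.
- exact Hxy.
- exists t; split; [exact Ht|].
  rewrite clamped_hatE in HM by (unfold inI; lra); split; [exact HM|].
  intros s Hxsy; specialize (Hs s Hxsy).
  rewrite !clamped_hatE in Hs by (unfold inI; lra); exact Hs.
Qed.

Lemma decrease_derivative_on_I (p q : R) :
  0 <= p -> p < q -> q <= 1 -> delta_hat delta q < delta_hat delta p ->
  exists s l, p < s < q /\ l < 0 /\ has_derivative_on_I (delta_hat delta) s l.
Proof.
intros Hp Hpq Hq Hlt.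
destruct (lipschitz_decrease_derivative clamped_hat p q) as [s [l [Hs [Hl HD]]]].
- apply lipschitz_le, clamped_hat_slope.
- exact Hpq.
- rewrite !clamped_hatE by (unfold inI; lra); exact Hlt.
- exists s, l; split; [exact Hs|split; [exact Hl|]].
  intros e He; destruct (HD e He) as [d [Hd Hh]].
  exists d; split; [exact Hd|]; intros h Hh0 Hhd Hsh.
  rewrite <- !clamped_hatE by (assumption || (unfold inI; lra)).
  apply Hh; assumption.
Qed.

Lemma increase_derivative_on_I (p q : R) :
  0 <= p -> p < q -> q <= 1 -> delta_hat delta p < delta_hat delta q ->
  exists s l, p < s < q /\ 0 < l /\ has_derivative_on_I (delta_hat delta) s l.
Proof.
intros Hp Hpq Hq Hlt.
destruct (lipschitz_decrease_derivative (fun x => - clamped_hat x) p q)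
  as [s [l [Hs [Hl HD]]]].
- apply lipschitz_le; intros x y Hxy.
  assert (K := clamped_hat_slope x y Hxy); lra.
- exact Hpq.
- rewrite !clamped_hatE by (unfold inI; lra); lra.
- exists s, (- l); split; [exact Hs|split; [lra|]].
  intros e He; destruct (HD e He) as [d [Hd Hh]].
  exists d; split; [exact Hd|]; intros h Hh0 Hhd Hsh.
  rewrite <- !clamped_hatE by (assumption || (unfold inI; lra)).
  rewrite <- Rabs_Ropp.
  replace (- _) with ((- clamped_hat (s + h) - - clamped_hat s) / h - l)
    by (field; exact Hh0).
  apply Hh; assumption.
Qed.

End Diagonal.

(** * From condition (ii) to copulas attaining the bound *)

Lemma has_derivative_neg_lt (f : R -> R) (x w l : R) :
  has_derivative_on_I f x l -> l < 0 -> inI x -> inI w -> x < w ->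
  exists z, x < z < w /\ f z < f x.
Proof.
(* The tolerance [- l] keeps the difference quotient negative. *)
intros HD Hl Hx Hw Hxw; destruct (HD (- l) ltac:(lra)) as [d [Hd Hh]].
set (h := Rmin d (w - x) / 2).
assert (0 < h < d /\ h < w - x).
{ unfold h, Rmin; destruct Rle_dec; lra. }
assert (K := Hh h ltac:(lra) ltac:(rewrite Rabs_pos_eq; lra)
               ltac:(unfold inI in *; lra)).
apply Rabs_lt_between in K.
exists (x + h); split; [lra|].
assert (Hq : (f (x + h) - f x) / h < 0) by lra.
assert (f (x + h) - f x = (f (x + h) - f x) / h * h) by (field; lra).
nra.
Qed.

Lemma has_derivative_pos_lt (f : R -> R) (x w l : R) :
  has_derivative_on_I f x l -> 0 < l -> inI x -> inI w -> w < x ->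
  exists z, w < z < x /\ f z < f x.
Proof.
intros HD Hl Hx Hw Hxw; destruct (HD l Hl) as [d [Hd Hh]].
set (h := Rmin d (x - w) / 2).
assert (0 < h < d /\ h < x - w).
{ unfold h, Rmin; destruct Rle_dec; lra. }
assert (K := Hh (- h) ltac:(lra) ltac:(rewrite Rabs_left; lra)
               ltac:(unfold inI in *; lra)).
apply Rabs_lt_between in K.
exists (x + - h); split; [lra|].
assert (Hq : 0 < (f (x + - h) - f x) / - h) by lra.
assert (f (x + - h) - f x = (f (x + - h) - f x) / - h * - h) by (field; lra).
nra.
Qed.

(** Condition (ii) of the theorem as a predicate on [delta]. *)
Definition separated (delta : R -> R) : Prop :=
  forall x y lx ly, inI x -> inI y -> x < y ->
    has_derivative_on_I (delta_hat delta) x lx ->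
    has_derivative_on_I (delta_hat delta) y ly ->
    lx < 0 -> 0 < ly ->
    y - x >= Rmax (delta_hat delta x) (delta_hat delta y).

Section Attained.

Variable delta : R -> R.
Hypothesis Hdelta : is_diagonal_section delta.
Hypothesis Hsep : separated delta.

(** A drop before [t] gives a point [s] of negative derivative, then a rise back to the maximum
    gives a later [u < t] of positive derivative. Condition (ii) bounds [delta_hat delta u] by
    [u - s], hence [delta_hat delta t] by [t - s < b - a], a contradiction. *)
Lemma increasing_before_max (a t b : R) :
  0 <= a -> a <= t -> t <= b -> b <= 1 -> b - a <= delta_hat delta t ->
  (forall s, a <= s <= b -> delta_hat delta s <= delta_hat delta t) ->
  forall x y, a <= x -> x <= y -> y <= t ->
    delta_hat delta x <= delta_hat delta y.
Proof.
intros Ha Hat Htb Hb Hbig Hmax x y Hx Hxy Hy.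
apply Rnot_lt_le; intros Hlt.
assert (Hne : x <> y) by (intros ->; lra).
destruct (decrease_derivative_on_I delta Hdelta x y)
  as [s [ls [Hs [Hls Ds]]]]; try lra.
destruct (has_derivative_neg_lt _ s y ls Ds Hls) as [s' [Hs' Hlt']];
  try (unfold inI; lra).
assert (Hst := Hmax s ltac:(lra)).
destruct (increase_derivative_on_I delta Hdelta s' t)
  as [u [lu [Hu [Hlu Du]]]]; try lra.
assert (K := Hsep s u ls lu ltac:(unfold inI; lra) ltac:(unfold inI; lra)
               ltac:(lra) Ds Du Hls Hlu).
assert (M := Rmax_r (delta_hat delta s) (delta_hat delta u)).
assert (L := delta_hat_slope delta Hdelta u t ltac:(lra) ltac:(lra) ltac:(lra)).
lra.
Qed.

(** Mirror image of the preceding argument: the descent is found between [t] and the rise, and (ii)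
    is used through [delta_hat delta s]. *)
Lemma decreasing_after_max (a t b : R) :
  0 <= a -> a <= t -> t <= b -> b <= 1 -> b - a <= delta_hat delta t ->
  (forall s, a <= s <= b -> delta_hat delta s <= delta_hat delta t) ->
  forall x y, t <= x -> x <= y -> y <= b ->
    delta_hat delta y <= delta_hat delta x.
Proof.
intros Ha Hat Htb Hb Hbig Hmax x y Hx Hxy Hy.
apply Rnot_lt_le; intros Hlt.
assert (Hne : x <> y) by (intros ->; lra).
destruct (increase_derivative_on_I delta Hdelta x y)
  as [u [lu [Hu [Hlu Du]]]]; try lra.
destruct (has_derivative_pos_lt _ u x lu Du Hlu) as [u' [Hu' Hlt']];
  try (unfold inI; lra).
assert (Hut := Hmax u ltac:(lra)).
destruct (decrease_derivative_on_I delta Hdelta t u')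
  as [s [ls [Hs [Hls Ds]]]]; try lra.
assert (K := Hsep s u ls lu ltac:(unfold inI; lra) ltac:(unfold inI; lra)
               ltac:(lra) Ds Du Hls Hlu).
assert (M := Rmax_l (delta_hat delta s) (delta_hat delta u)).
assert (L := delta_hat_slope delta Hdelta t s ltac:(lra) ltac:(lra) ltac:(lra)).
lra.
Qed.

Lemma copula_of_large_max (x y t : R) : 0 <= x -> x <= t -> t <= y -> y <= 1 ->
  y - x <= delta_hat delta t ->
  (forall s, x <= s <= y -> delta_hat delta s <= delta_hat delta t) ->
  exists C, is_copula C /\ has_diagonal C delta /\
    C x y = Rmin x (y - delta_hat delta t).
Proof.
intros Hx Hxt Hty Hy Hbig Hmax.
apply unimodal_copula; try assumption.
- apply (increasing_before_max x t y); assumption.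
- apply (decreasing_after_max x t y); assumption.
Qed.

Lemma exact_range_end (x y : R) : 0 <= x -> x <= y -> y <= 1 ->
  range_max (clamped_hat delta) x y <= y - x ->
  exists z, x <= z <= y /\ range_max (clamped_hat delta) x z = z - x.
Proof.
intros Hx Hxy Hy Hle.
(* The zero of [h] is the required end point: [h x = - delta_hat delta x <= 0 <= h y]. [Rmax x s]
   freezes the range below [x], which keeps [h] Lipschitz on the whole line. *)
set (h := fun s => s - x - range_max (clamped_hat delta) x (Rmax x s)).
assert (Hslope := clamped_hat_slope delta Hdelta).
destruct (IVT_cor h x y) as [z [Hz Hz0]].
- apply lipschitz_continuity, lipschitz_le; intros u v Huv; unfold h.
  assert (K := range_max_right _ Hslope x (Rmax x u) (Rmax x v)).
  assert (Rmax x u <= Rmax x v <= Rmax x u + (v - u)).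
  { unfold Rmax; repeat destruct Rle_dec; lra. }
  assert (L := Rmax_l x u); lra.
- exact Hxy.
- unfold h; rewrite (Rmax_left x x), (Rmax_right x y) by lra.
  rewrite range_max_diag, clamped_hatE by (assumption || (unfold inI; lra)).
  assert (K := delta_hat_bounds delta Hdelta x ltac:(unfold inI; lra)).
  nra.
- exists z; split; [exact Hz|].
  unfold h in Hz0; rewrite Rmax_right in Hz0 by lra; lra.
Qed.

Lemma copula_attains_bound (x y : R) : 0 <= x -> x <= y -> y <= 1 ->
  exists C t, is_copula C /\ has_diagonal C delta /\ x <= t <= y /\
    Rmin x (y - delta_hat delta t) <= C x y.
Proof.
intros Hx Hxy Hy.
destruct (delta_hat_max delta Hdelta x y Hx Hxy Hy) as [t [Ht [HM Hmax]]].
destruct (Rle_dec (y - x) (delta_hat delta t)) as [Hbig|Hsmall].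
- destruct (copula_of_large_max x y t) as [C [HC [HD HE]]]; try lra; auto.
  exists C, t; split; [exact HC|split; [exact HD|lra]].
(* At [(x, z)] the bound equals [x], so the copula attaining it there has [C x z = x], and
   monotonicity gives [C x y >= x]. *)
- destruct (exact_range_end x y) as [z [Hz HMz]]; try lra.
  destruct (delta_hat_max delta Hdelta x z) as [t' [Ht' [HM' Hmax']]]; try lra.
  destruct (copula_of_large_max x z t') as [C [HC [HD HE]]]; try lra; auto.
  exists C, t; split; [exact HC|split; [exact HD|split; [exact Ht|]]].
  replace (z - delta_hat delta t') with x in HE by lra.
  rewrite (Rmin_left x x) in HE by lra.
  assert (M := copula_mono_r C HC z y x).
  assert (L := Rmin_l x (y - delta_hat delta t)).
  unfold inI in *; lra.
Qed.

End Attained.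

(** * The greatest quasi-copula with diagonal section [delta], and the gap left by copulas *)

Definition range_max_bound (delta : R -> R) (x y : R) : R :=
  Rmin (Rmin x y)
    (Rmax x y - range_max (clamped_hat delta) (Rmin x y) (Rmax x y)).

Lemma range_max_bound_sym (delta : R -> R) (x y : R) :
  range_max_bound delta x y = range_max_bound delta y x.
Proof.
unfold range_max_bound; rewrite (Rmin_comm x y), (Rmax_comm x y); reflexivity.
Qed.

Lemma range_max_bound_le (delta : R -> R) (x y : R) : x <= y ->
  range_max_bound delta x y = Rmin x (y - range_max (clamped_hat delta) x y).
Proof.
intros Hxy; unfold range_max_bound.
rewrite (Rmin_left x y), (Rmax_right x y) by lra; reflexivity.
Qed.

Section RangeMaxBound.

Variable delta : R -> R.
Hypothesis Hdelta : is_diagonal_section delta.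

Let D := clamped_hat delta.

Let D_slope : forall x y, x <= y -> - (y - x) <= D y - D x <= y - x.
Proof. apply clamped_hat_slope, Hdelta. Qed.

(** The section is cut at the diagonal point [x = y]; on each side it is a minimum of two functions
    with slopes in [[0, 1]], as moving one end of the range changes the maximum by at most the
    displacement. *)
Lemma range_max_bound_slow (y : R) :
  inI y -> slow (fun x => range_max_bound delta x y) 0 1.
Proof.
intros Hy; apply (slow_glue _ 0 y 1); [exact Hy| |].
- apply slow_ext with (fun x => Rmin x (y - range_max D x y)).
  + intros x Hx; apply range_max_bound_le; lra.
  + apply slow_min; intros u v Hu Huv Hv; [lra|].
    assert (K := range_max_left D D_slope u v y Huv Hv); lra.
- apply slow_ext with (fun x => Rmin y (x - range_max D y x)).
  + intros x Hx; rewrite range_max_bound_sym; apply range_max_bound_le; lra.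
  + apply slow_min; intros u v Hu Huv Hv; [lra|].
    assert (K := range_max_right D D_slope y u v Hu Huv); lra.
Qed.

Lemma range_max_bound_boundary (x : R) : inI x ->
  range_max_bound delta x 0 = 0 /\ range_max_bound delta x 1 = x.
Proof.
intros Hx; rewrite range_max_bound_sym; rewrite !range_max_bound_le by apply Hx.
destruct (delta_hat_max delta Hdelta 0 x) as [t [Ht [-> _]]];
  try (unfold inI in *; lra).
destruct (delta_hat_max delta Hdelta x 1) as [s [Hs [-> _]]];
  try (unfold inI in *; lra).
assert (Kt := delta_hat_bounds delta Hdelta t ltac:(unfold inI in *; lra)).
assert (Ks := delta_hat_bounds delta Hdelta s ltac:(unfold inI in *; lra)).
rewrite !Rmin_left by lra; split; reflexivity.
Qed.

Lemma range_max_bound_quasi_copula : is_quasi_copula (range_max_bound delta).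
Proof.
apply slope_quasi_copula.
- intros x Hx; destruct (range_max_bound_boundary x Hx) as [H0 H1].
  rewrite (range_max_bound_sym delta 0 x), (range_max_bound_sym delta 1 x); auto.
- intros x1 x2 y H1 H2 Hy H12.
  rewrite (range_max_bound_sym delta y x2), (range_max_bound_sym delta y x1).
  assert (K := range_max_bound_slow y Hy x1 x2); unfold inI in *.
  cbv beta in K; lra.
Qed.

Lemma range_max_bound_diagonal : has_diagonal (range_max_bound delta) delta.
Proof.
intros t Ht; rewrite range_max_bound_le by lra.
rewrite range_max_diag, clamped_hatE by assumption.
assert (K := delta_hat_bounds delta Hdelta t Ht).
rewrite Rmin_right by lra; unfold delta_hat; lra.
Qed.

(* If [delta_hat] drops right after [s] or rises right before [u], the
   increments of [delta_hat] over [s, u] exceed [range_max - delta_hat s]. *)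
Lemma copula_gap (s u ls lu : R) : inI s -> inI u -> s < u ->
  has_derivative_on_I (delta_hat delta) s ls ->
  has_derivative_on_I (delta_hat delta) u lu ->
  ls < 0 -> 0 < lu ->
  exists kappa, 0 < kappa /\
    forall C, is_copula C -> has_diagonal C delta ->
      C s u <= u - range_max D s u - kappa.
Proof.
intros Hs Hu Hsu Ds Du Hls Hlu.
destruct (delta_hat_max delta Hdelta s u) as [t [Ht [HM _]]];
  try (unfold inI in *; lra).
fold D in HM; rewrite HM; unfold delta_hat in *.
(* [kappa] is the size of the extra rise or drop and is independent of [C], so the gap survives the
   supremum. Strips where [delta_hat] rises ([[u', u]], respectively [[s', t]]) take the estimate
   [delta w - delta v], the others [w - v]. *)
destruct (Req_dec s t) as [Hst|Hst].
- destruct (has_derivative_pos_lt _ u s lu Du Hlu Hu Hs Hsu) as [u' [Hu' Hlt]].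
  exists (u - delta u - (u' - delta u')); split; [lra|]; intros C HC HD.
  assert (K1 := copula_strip_bound C delta s s u' HC HD Hs).
  assert (K2 := copula_strip_bound C delta s u' u HC HD Hs).
  assert (K := HD s Hs); subst t; unfold inI in *; lra.
- destruct (has_derivative_neg_lt _ s t ls Ds Hls Hs) as [s' [Hs' Hlt]];
    try (unfold inI in *; lra).
  exists (s - delta s - (s' - delta s')); split; [lra|]; intros C HC HD.
  assert (K1 := copula_strip_bound C delta s s s' HC HD Hs).
  assert (K2 := copula_strip_bound C delta s s' t HC HD Hs).
  assert (K3 := copula_strip_bound C delta s t u HC HD Hs).
  assert (K := HD s Hs); unfold inI in *; lra.
Qed.

End RangeMaxBound.

(** * Comparison of the two suprema *)

Lemma Cbar_le_Adelta (delta : R -> R) (x y : R) :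
  Rbar_le (Cbar delta x y) (Adelta delta x y).
Proof.
apply is_lub_Rbar_subset with (3 := Lub_Rbar_correct _) (2 := Lub_Rbar_correct _).
intros z [C [HC [HD Hz]]]; exists C.
split; [apply copula_quasi_copula, HC|split; assumption].
Qed.

Lemma copula_le_Cbar (delta : R -> R) (C : R -> R -> R) (x y : R) :
  is_copula C -> has_diagonal C delta -> Rbar_le (C x y) (Cbar delta x y).
Proof.
intros HC HD.
apply (proj1 (Lub_Rbar_correct
  (fun z => exists C, is_copula C /\ has_diagonal C delta /\ z = C x y))).
exists C; auto.
Qed.

Theorem theorem3p9 (delta : R -> R) (Hdelta : is_diagonal_section delta) :
  (forall x y, inI x -> inI y -> Cbar delta x y = Adelta delta x y)
  <->
  (forall x y lx ly, inI x -> inI y -> x < y ->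
     has_derivative_on_I (delta_hat delta) x lx ->
     has_derivative_on_I (delta_hat delta) y ly ->
     lx < 0 -> 0 < ly ->
     y - x >= Rmax (delta_hat delta x) (delta_hat delta y)).
Proof.
split.
- intros Heq s u ls lu Hs Hu Hsu Ds Du Hls Hlu.
  apply Rnot_lt_ge; intros Hlt.
  destruct (copula_gap delta Hdelta s u ls lu Hs Hu Hsu Ds Du Hls Hlu)
    as [kappa [Hkappa HC]].
  set (M := range_max (clamped_hat delta) s u) in HC.
  (* Failure of (ii) puts [u - M] below [s], so [range_max_bound] equals [u - M] at [(s, u)], a
     value that every copula misses by at least [kappa]. *)
  assert (HM : u - s < M).
  { apply Rlt_le_trans with (1 := Hlt).
    assert (Hslope := clamped_hat_slope delta Hdelta).
    rewrite <- (clamped_hatE delta s Hs), <- (clamped_hatE delta u Hu).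
    apply Rmax_lub; apply range_max_ub; (exact Hslope || lra). }
  assert (Hup : Rbar_le (Cbar delta s u) (u - M - kappa)).
  { apply Lub_Rbar_correct; intros z [C [HCC [HD ->]]]; apply HC; assumption. }
  rewrite (Heq s u Hs Hu) in Hup.
  assert (Hlow : Rbar_le (u - M) (Adelta delta s u)).
  { apply Lub_Rbar_correct; exists (range_max_bound delta).
    split; [apply range_max_bound_quasi_copula, Hdelta|].
    split; [apply range_max_bound_diagonal, Hdelta|].
    rewrite range_max_bound_le by lra; rewrite Rmin_right; fold M; lra. }
  assert (H := Rbar_le_trans _ _ _ Hlow Hup); simpl in H; lra.
- intros Hsep x y Hx Hy; apply Rbar_le_antisym; [apply Cbar_le_Adelta|].
  apply Lub_Rbar_correct; intros z [Q [HQ [HD ->]]].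
  destruct (Rle_dec x y) as [Hxy|Hxy].
  + destruct (copula_attains_bound delta Hdelta Hsep x y (proj1 Hx) Hxy (proj2 Hy))
      as [C [t [HC [HDC [Ht Hle]]]]].
    apply Rbar_le_trans with (2 := copula_le_Cbar delta C x y HC HDC).
    apply Rle_trans with (2 := Hle).
    apply quasi_copula_upper_bound; assumption.
  (* Below the diagonal both functions are transposed, which preserves the two classes and the
     diagonal section. *)
  + destruct (copula_attains_bound delta Hdelta Hsep y x (proj1 Hy) ltac:(lra) (proj2 Hx))
      as [C [t [HC [HDC [Ht Hle]]]]].
    apply Rbar_le_trans with (2 := copula_le_Cbar delta (fun u v => C v u) x y
                                     (copula_transpose C HC) HDC).
    apply Rle_trans with (2 := Hle).
    apply (quasi_copula_upper_bound (fun u v => Q v u)); try assumption.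
    apply quasi_copula_transpose, HQ.
Qed.
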